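(* Let $d\ge 1$, $\varepsilon\ge 0$, and let $S=(\bm{x}_i,z_i)_{i=1,\dots,N}$ be a set of $N\ge d+1$ points in $\mathbb{R}^{d+1}$ with $(\bm{x}_i)_{i=1,\dots,N}$ in general position in $\mathbb{R}^d$. Then any CPWL $\varepsilon$-approximation of $S$ has a well-behaved version with respect to $S$.
   Context: General position: any subset of $d+1$ of the points $\bm{x}_i$ is affinely independent. Let $S_{\mathbb{R}^d}=\{\bm{x}_1,\dots,\bm{x}_N\}$ and let $D$ be the convex hull of $S_{\mathbb{R}^d}$. CPWL function: $f:D\to\mathbb{R}$ is CPWL when $f$ is continuous and there is a finite set of affine functions $\{f_k:D_k\to\mathbb{R},\ k=1,\dots,P\}$ such that the $D_k$ are compact, $\bigcup_{k=1}^P D_k=D$ and $f_{|D_k}=f_k$ for all $k$. The $f_k$ are the affine pieces of $f$ and the $D_k$ its affine domains. The $D_k$ need not form a partition of $D$: the intersection of two affine domains may have non-empty interior, an affine domain can be empty, and two affine domains can be equal as long as the corresponding affine pieces are equal. The family of affine pieces representing $f$ is not unique; a CPWL function is considered together with a chosen family of affine pieces. Interpolation and approximation: $f:D\to\mathbb{R}$ interpolates $S$ when $f(\bm{x}_i)=z_i$ for all $i$; $f$ is an $\varepsilon$-approximation of $S$ when $\max_i|f(\bm{x}_i)-z_i|\le\varepsilon$. An affine piece $f_k:D_k\to\mathbb{R}$ of an interpolation of a point set interpolates the point $(\bm{x}_i,z_i)$ when $\bm{x}_i\in D_k$ and $f_k(\bm{x}_i)=z_i$. Well-behaved interpolation: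 a CPWL interpolation $f$ of $S$ is well-behaved when each affine piece of $f$ interpolates at least $d+1$ points of $S$. Well-behaved version of an interpolation: let $f,g$ be CPWL interpolations of $S$ composed of affine pieces $\{f_k:D_k\to\mathbb{R},\ k=1,\dots,P\}$ and $\{g_k:D'_k\to\mathbb{R},\ k=1,\dots,P\}$. Then $g$ is a well-behaved version of $f$ with respect to $S$ if $g$ is a well-behaved CPWL interpolation of $S$ and $D_k\cap S_{\mathbb{R}^d}\subseteq D'_k\cap S_{\mathbb{R}^d}$ for all $k$. Well-behaved version of an $\varepsilon$-approximation: let $f,g$ be CPWL $\varepsilon$-approximations of $S$ and $e_i=f(\bm{x}_i)-z_i$. Then $g$ is a well-behaved version of the $\varepsilon$-approximation $f$ with respect to $S$ if $g$ is a well-behaved version of the CPWL interpolation $f$ with respect to $(\bm{x}_i,z_i+e_i)_{i=1,\dots,N}$. *)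

(* Defs.v *)
From mathcomp Require Import all_boot all_order all_algebra.
From mathcomp Require Import all_classical all_reals all_analysis.

Set Implicit Arguments.
Unset Strict Implicit.
Unset Printing Implicit Defensive.

Import Order.TTheory GRing.Theory Num.Theory.
Import numFieldNormedType.Exports.
Local Open Scope classical_set_scope.
Local Open Scope ring_scope.

(* A point set S = (x_i, z_i) is given by the families x and z; subsets of S
   are sets of indices.  General position forces x to be injective as soon as
   0 < d < N, so counting indices then amounts to counting points. *)

Definition affinely_independent (R : realType) (d N : nat)
    (x : 'I_N -> 'rV[R]_d) (A : {set 'I_N}) : Prop :=
  forall c : 'I_N -> R,
    \sum_(i in A) c i = 0 -> \sum_(i in A) c i *: x i = 0 ->
    forall i, i \in A -> c i = 0.

Definition general_position (R : realType) (d N : nat)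
    (x : 'I_N -> 'rV[R]_d) : Prop :=
  forall A : {set 'I_N}, #|A| = d.+1 -> affinely_independent x A.

Definition hull (R : realType) (d N : nat) (x : 'I_N -> 'rV[R]_d) :
    set 'rV[R]_d :=
  smallest (@convex_set R 'rV[R]_d) (range x).

Definition affine_function (R : realType) (d : nat) (h : 'rV[R]_d -> R) :
    Prop :=
  exists (l : {scalar 'rV[R]_d}) (b : R), forall p, h p = l p + b.

(* A CPWL function on D together with a chosen family of P affine pieces.
   Functions on D, resp. on an affine domain, are encoded by total functions
   whose values outside D, resp. outside the affine domain, are irrelevant:
   the k-th affine piece is the restriction of [piece k] to [dom k].  In
   particular pieces with equal affine domains are equal, both being
   restrictions of the same function. *)
Record cpwl (R : realType) (d : nat) (D : set 'rV[R]_d) (P : nat) := Cpwl {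
  cpwl_fun :> 'rV[R]_d -> R ;
  piece : 'I_P -> 'rV[R]_d -> R ;
  dom : 'I_P -> set 'rV[R]_d ;
  cpwl_continuous : {within D, continuous cpwl_fun} ;
  piece_affine : forall k, affine_function (piece k) ;
  dom_compact : forall k, compact (dom k) ;
  dom_cover : \bigcup_k dom k = D ;
  cpwl_piece : forall k p, dom k p -> cpwl_fun p = piece k p
}.

Definition interpolates (R : realType) (d N : nat) (x : 'I_N -> 'rV[R]_d)
    (z : 'I_N -> R) (f : 'rV[R]_d -> R) : Prop :=
  forall i, f (x i) = z i.

(* The neutral element 0 does not affect the maximum, since the |f(x_i) - z_i|
   are nonnegative. *)
Definition approximates (R : realType) (d N : nat) (x : 'I_N -> 'rV[R]_d)
    (z : 'I_N -> R) (eps : R) (f : 'rV[R]_d -> R) : Prop :=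
  \big[Num.max/0]_(i < N) `|f (x i) - z i| <= eps.

Definition piece_interpolates (R : realType) (d N P : nat)
    (x : 'I_N -> 'rV[R]_d) (z : 'I_N -> R) (f : cpwl (hull x) P)
    (k : 'I_P) (i : 'I_N) : Prop :=
  dom f k (x i) /\ piece f k (x i) = z i.

Definition well_behaved (R : realType) (d N P : nat)
    (x : 'I_N -> 'rV[R]_d) (z : 'I_N -> R) (f : cpwl (hull x) P) : Prop :=
  interpolates x z f /\
  forall k, exists A : {set 'I_N},
    (d.+1 <= #|A|)%N /\ forall i, i \in A -> piece_interpolates z f k i.

Definition well_behaved_version (R : realType) (d N P : nat)
    (x : 'I_N -> 'rV[R]_d) (z : 'I_N -> R) (f g : cpwl (hull x) P) : Prop :=
  [/\ interpolates x z f,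
      well_behaved z g
    & forall k, dom f k `&` range x `<=` dom g k `&` range x].

Definition well_behaved_version_approx (R : realType) (d N P : nat)
    (x : 'I_N -> 'rV[R]_d) (z : 'I_N -> R) (eps : R)
    (f g : cpwl (hull x) P) : Prop :=
  let e i := f (x i) - z i in
  [/\ approximates x z eps f,
      approximates x z eps g
    & well_behaved_version (fun i => z i + e i) f g].

(* Main.v *)
From HB Require Import structures.
Require Import Defs.
From mathcomp Require Import all_boot all_order all_algebra.
From mathcomp Require Import all_classical all_reals all_analysis.
From mathcomp Require Import ring lra zify.

Set Implicit Arguments.
Unset Strict Implicit.
Unset Printing Implicit Defensive.

Import Order.TTheory GRing.Theory Num.Theory.
Import numFieldNormedType.Exports.
Local Open Scope classical_set_scope.
Local Open Scope ring_scope.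

(* Write w_i = f(x_i).  At the points x_i, the function f agrees with the
   max-min expression max_i min {f_k | f_k(x_i) >= w_i}: restricted to the
   segment from x_i to x_j, f must have a piece f_k with f_k(x_i) >= w_i and
   f_k(x_j) <= w_j.  The value of this expression at x_i remains w_i when the
   pieces are moved without changing the weak signs of f_k(x_i) - w_i.  For each
   k, the affine functions satisfying these sign constraints form a polyhedron
   which contains no line, because the points are in general position; a vertex
   g_k of it takes the value w_i at d + 1 of the points at least.  Then g is the
   same max-min expression in the g_k, with affine domains {g = g_k}. *)

(** * Sign constraints and vertices of the polyhedra they define *)

Definition sign_compatible (R : realFieldType) (a b : R) : Prop :=
  (0 <= a -> 0 <= b) /\ (a <= 0 -> b <= 0).

Lemma sign_compatible_refl (R : realFieldType) (a : R) : sign_compatible a a.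
Proof. by []. Qed.

Lemma sign_compatible_trans (R : realFieldType) (a b c : R) :
  sign_compatible a b -> sign_compatible b c -> sign_compatible a c.
Proof. by move=> [p q] [r s]; split=> [/p/r|/q/s]. Qed.

Lemma sign_compatible0 (R : realFieldType) (b : R) :
  sign_compatible 0 b -> b = 0.
Proof. by case=> p q; apply/le_anti; rewrite p ?q. Qed.

(** These are fewer than [n] linear equations in [n] unknowns, so the columns in [A] have a nonzero
    left kernel. *)
Lemma nonzero_vanishing (R : fieldType) n N (X : 'M[R]_(n, N))
    (A : {set 'I_N}) : (#|A| < n)%N ->
  exists2 h : 'rV[R]_n, h != 0 & forall i, i \in A -> (h *m X) 0 i = 0.
Proof.
move=> ltAn; pose Q := colsub (@enum_val _ (mem A)) X.
have /rowV0Pn[h /sub_kermxP hQ h0] : kermx Q != 0.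
  rewrite kermx_eq0 /row_free; apply/eqP => rQ.
  by have := rank_leq_col Q; rewrite rQ leqNgt ltAn.
exists h => // i iA.
rewrite -(enum_rankK_in iA iA); move/matrixP/(_ 0 (enum_rank_in iA i)): hQ.
rewrite !mxE => hQi; rewrite -[RHS]hQi.
by apply: eq_bigr => a _; rewrite mxE.
Qed.

Definition active (R : eqType) N (a w : 'I_N -> R) : {set 'I_N} :=
  [set i | a i == w i]%SET.

Lemma active_in (R : eqType) N (a w : 'I_N -> R) i :
  (i \in active a w) = (a i == w i).
Proof. by rewrite inE. Qed.

(* Move u along a line contained in all active hyperplanes until it first hits
   another one. *)
Lemma sign_compatible_step (R : realFieldType) n N (X : 'M[R]_(n, N))
    (u : 'rV[R]_n) (w : 'I_N -> R) :
  row_free X -> (#|active ((u *m X) 0)%R w| < n)%N ->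
  exists2 v : 'rV[R]_n,
    forall i, sign_compatible ((u *m X) 0 i - w i) ((v *m X) 0 i - w i) &
    exists2 i, (u *m X) 0 i != w i & (v *m X) 0 i == w i.
Proof.
move=> Xfree /(@nonzero_vanishing _ _ _ X)[h h0 hA].
pose e i := w i - (u *m X) 0 i.
have : h *m X != 0 by rewrite mulmx_free_eq0.
case/rV0Pn => j rj0.
have ej0 : e j != 0.
  apply: contraNneq rj0 => /eqP; rewrite subr_eq0 eq_sym => ej.
  by rewrite hA // active_in.
(* The direction is rescaled so that hyperplane [j] is hit at time 1, as [r j = e j]. Hence some
   hitting time [e i / r i] is positive, and the least positive one exists. *)
pose r i := (e j / (h *m X) 0 j) * (h *m X) 0 i.
have rj : r j = e j by rewrite /r divfK.
have Pj : (r j != 0) && (0 < e j / r j) by rewrite rj ej0 divff ?ltr01.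
case: (@Order.TotalTheory.arg_minP _ _ _ j (fun i => (r i != 0) && (0 < e i / r i))
  (fun i => e i / r i) Pj) => k /andP[rk0 tk0] kmin.
set t := e k / r k in tk0 kmin.
have vE i : ((u + (t * (e j / (h *m X) 0 j)) *: h) *m X) 0 i - w i
    = t * r i - e i.
  by rewrite mulmxDl -scalemxAl mxE [X in _ + X - _]mxE /r /e; ring.
exists (u + (t * (e j / (h *m X) 0 j)) *: h) => [i|].
  rewrite vE -opprB -/(e i).
  have [ei0|ei0] := eqVneq (e i) 0.
    have -> : r i = 0 by rewrite /r (hA i) ?mulr0 // active_in eq_sym -subr_eq0 -/(e i) ei0.
    by rewrite ei0 mulr0 subr0 oppr0; exact: sign_compatible_refl.
  have [ri0|ri0] := eqVneq (r i) 0.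
    by rewrite ri0 mulr0 sub0r; exact: sign_compatible_refl.
  (* A positive hitting time of [i] is at least [t], so hyperplane [i] is not crossed; a negative
     one means that the line moves away from it. *)
  have [tei|nei] := ltP 0 (e i / r i).
    have := kmin i; rewrite ri0 tei => /(_ isT) le_t.
    have eiE : e i = (e i / r i) * r i by rewrite divfK.
    split=> hei.
      have hr : r i < 0 by nra.
      nra.
    have hr : 0 < r i.
      have : 0 < e i by rewrite lt_neqAle eq_sym ei0 -oppr_le0.
      nra.
    nra.
  have eiE : e i = (e i / r i) * r i by rewrite divfK.
  split=> hei.
    have : e i < 0 by rewrite lt_neqAle ei0 -oppr_ge0.
    nra.
  have : 0 < e i by rewrite lt_neqAle eq_sym ei0 -oppr_le0.
  nra.
exists k.
  apply: contraTneq tk0 => uk.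
  by rewrite /t /e uk subrr mul0r ltxx.
by rewrite -subr_eq0 vE /t divfK // subrr.
Qed.

(** Sign compatibility keeps active constraints active, so each step strictly enlarges the active
    set; the induction is on the number of constraints still missing. *)
Lemma sign_compatible_vertex (R : realFieldType) n N (X : 'M[R]_(n, N))
    (u : 'rV[R]_n) (w : 'I_N -> R) :
  row_free X ->
  exists2 v : 'rV[R]_n,
    forall i, sign_compatible ((u *m X) 0 i - w i) ((v *m X) 0 i - w i) &
    (n <= #|active ((v *m X) 0)%R w|)%N.
Proof.
move=> Xfree; move: {2}(n - _)%N (leqnn (n - #|active ((u *m X) 0)%R w|)) => m.
elim: m u => [|m IH] u.
  rewrite leqn0 subn_eq0 => le_n; exists u => // i; exact: sign_compatible_refl.
move=> le_m.
have [le_n|lt_n] := leqP n #|active ((u *m X) 0)%R w|.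
  by exists u => // i; exact: sign_compatible_refl.
have [v uv [k uk vk]] := sign_compatible_step Xfree lt_n.
have [|v' vv' v'n] := IH v.
  have : (#|active ((u *m X) 0)%R w| < #|active ((v *m X) 0)%R w|)%N.
    apply/proper_card/properP; split; last by exists k; rewrite active_in // (negbTE uk).
    apply/fintype.subsetP => i; rewrite !active_in => /eqP ui.
    by have := uv i; rewrite ui subrr => /sign_compatible0/eqP; rewrite subr_eq0.
  by move: le_m lt_n; lia.
exists v' => // i; exact: sign_compatible_trans (uv i) (vv' i).
Qed.

(** * Affine functions in homogeneous coordinates, and general position *)

(** The last entry of [v] is the constant term. *)
Definition affine_eval (R : realType) d (v : 'rV[R]_(d + 1)) (p : 'rV[R]_d) : R :=
  (v *m (row_mx p 1%:M)^T) 0 0.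

Section LinearForm.
Variables (R : realType) (d : nat) (c : 'rV[R]_d).
Definition linear_form (p : 'rV[R]_d) : R := (c *m p^T) 0 0.
Lemma linear_form_is_linear : linear_for *%R linear_form.
Proof.
by move=> a p q; rewrite /linear_form linearP mulmxDr -scalemxAr !mxE.
Qed.
HB.instance Definition _ :=
  GRing.isLinear.Build R 'rV[R]_d R *%R linear_form linear_form_is_linear.
End LinearForm.

Lemma affine_affine_eval (R : realType) d (v : 'rV[R]_(d + 1)) :
  affine_function (affine_eval v).
Proof.
exists (linear_form (lsubmx v) : {scalar 'rV[R]_d}), (rsubmx v 0 0) => p.
rewrite /affine_eval -{1}(hsubmxK v) tr_row_mx mul_row_col mxE /= trmx1 mulmx1.
by [].
Qed.

Lemma affine_evalP (R : realType) d (h : 'rV[R]_d -> R) :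
  affine_function h -> exists v, forall p, h p = affine_eval v p.
Proof.
move=> [l [b hE]]; exists (row_mx (\row_j l (delta_mx 0 j)) b%:M) => p.
rewrite hE /affine_eval tr_row_mx mul_row_col mxE trmx1 mulmx1 !mxE eqxx mulr1n.
congr (_ + _); rewrite {1}(row_sum_delta p) linear_sum; apply: eq_bigr => j _.
by rewrite !mxE linearZ mulrC.
Qed.

Definition lift_mx (R : realType) d N (x : 'I_N -> 'rV[R]_d) : 'M[R]_(d + 1, N) :=
  \matrix_(a, i) (row_mx (x i) 1%:M) 0 a.

Lemma mul_lift_mx (R : realType) d N (x : 'I_N -> 'rV[R]_d) v i :
  (v *m lift_mx x) 0 i = affine_eval v (x i).
Proof. by rewrite /affine_eval !mxE; apply: eq_bigr => a _; rewrite !mxE. Qed.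

(** A nonzero left kernel vector would make the square block at the first d + 1 points singular; a
    kernel vector of the transposed block is then an affine dependence between these points. *)
Lemma general_position_row_free (R : realType) d N (x : 'I_N -> 'rV[R]_d) :
  (d.+1 <= N)%N -> general_position x -> row_free (lift_mx x).
Proof.
rewrite -addn1 => hN hx; apply: inj_row_free => v vX0; apply/eqP.
apply/negPn/negP => v0.
pose f := widen_ord hN; pose B := colsub f (lift_mx x).
have : \det B == 0.
  apply/det0P; exists v => //; apply/rowP => a.
  move/rowP/(_ (f a)): vX0; rewrite !mxE => vXa; rewrite -[RHS]vXa.
  by apply: eq_bigr => b _; rewrite !mxE.
rewrite -det_tr => /det0P[w w0 wB].
case/rV0Pn: w0 => a wa0; apply/negP: wa0; apply/negPn.
have finj : injective f by move=> a1 a2 /(congr1 val) /= /val_inj.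
(* The default value of [insubd] occurs only outside the image of [f], where [c] is not summed. *)
pose c (i : 'I_N) := w 0 (insubd (rshift d ord0) (val i)).
have cf b : c (f b) = w 0 b by rewrite /c [val (f b)]/(val b) valKd.
have sumB b : \sum_a0 w 0 a0 * lift_mx x b (f a0) = 0.
  move/rowP/(_ b): wB; rewrite !mxE => wBb; rewrite -[RHS]wBb.
  by apply: eq_bigr => a0 _; rewrite !mxE.
rewrite -cf; apply/eqP.
apply: (hx (f @: 'I_(d + 1))); last exact: imset_f.
- by rewrite card_imset // card_ord addn1.
(* The last row of the block, made of ones, says that the coefficients sum to 0; the other rows give
   the vector relation. *)
- rewrite big_imset /=; last by move=> ? ? _ _; exact: finj.
  rewrite -[RHS](sumB (rshift d ord0)); apply: eq_bigr => b _.
  by rewrite cf mxE row_mxEr !mxE mulr1.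
- rewrite big_imset /=; last by move=> ? ? _ _; exact: finj.
  apply/rowP => j; rewrite summxE [RHS]mxE -[RHS](sumB (lshift 1 j)).
  apply: eq_bigr => b _.
  by rewrite cf mxE [in RHS]mxE row_mxEl.
Qed.

Lemma affine_vertex (R : realType) d N (x : 'I_N -> 'rV[R]_d) (w : 'I_N -> R) h :
  (d.+1 <= N)%N -> general_position x -> affine_function h ->
  exists g, [/\ affine_function g,
    forall i, sign_compatible (h (x i) - w i) (g (x i) - w i) &
    (d.+1 <= #|active (g \o x) w|)%N].
Proof.
move=> hN hx /affine_evalP[u hE].
have Xfree := general_position_row_free hN hx.
have [v uv nv] := sign_compatible_vertex u w Xfree.
exists (affine_eval v); split; first exact: affine_affine_eval.
  by move=> i; rewrite hE -!mul_lift_mx.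
rewrite -[d.+1]addn1 (leq_trans nv) // subset_leq_card //.
by apply/fintype.subsetP => i; rewrite !active_in mul_lift_mx.
Qed.

(** * Affine pieces along a segment *)

(** The k-th affine function takes the values [a k] at 0 and [a k + b k] at 1. Closedness of the
    finitely many [C k] supplies the continuity of [phi]. *)
Lemma decreasing_piece (R : realType) (P : nat) (phi : R -> R)
    (a b : 'I_P -> R) (C : 'I_P -> set R) :
  (forall k, closed (C k)) ->
  (forall t, 0 <= t <= 1 -> exists k, C k t) ->
  (forall k t, C k t -> phi t = a k + b k * t) ->
  0 < phi 0 -> phi 1 < 0 ->
  exists k, 0 <= a k /\ a k + b k <= 0.
Proof.
move=> Ccl Ccov Cphi phi0 phi1.
(* At the last point s where phi is nonnegative, a piece active both at s and
   just after s is decreasing. *)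
pose E := \bigcup_k (C k `&` ([set t | 0 <= t <= 1] `&` [set t | 0 <= a k + b k * t])).
have Ecl : closed E.
  apply: closed_bigcup => [|k _]; first exact: finite_finset.
  apply: closedI => //; apply: closedI.
    rewrite (_ : [set t | _] = [set t | 0 <= t] `&` [set t | t <= 1]).
      by apply: closedI; [exact: closed_ge | exact: closed_le].
    by apply/seteqP; split=> t /=; [move/andP|move=> [-> ->]].
  rewrite (_ : [set t | _] = (fun t => a k + b k * t) @^-1` [set y | 0 <= y]) //.
  apply: (iffLR (continuous_closedP _)); last exact: closed_ge.
  move=> t; apply: cvgD; first exact: cvg_cst.
  by apply: cvgM; [exact: cvg_cst | exact: cvg_id].
have EP t : E t <-> (0 <= t <= 1) /\ 0 <= phi t.
  split=> [[k _ [Ckt [t01 ge0]]]|[t01 ge0]]; first by rewrite (Cphi _ _ Ckt).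
  by have [k Ckt] := Ccov t t01; exists k => //; split=> //; split=> //=; rewrite -Cphi.
have E0 : E 0 by apply/EP; rewrite lexx ler01 ltW.
have Eub : ubound E 1 by move=> t /EP[/andP[]].
pose s := sup E.
have Es : E s.
  rewrite (iffLR (closure_id _) Ecl); apply: closure_sup; first by exists 0.
  by exists 1.
have s01 : 0 <= s <= 1 by case/EP: (Es).
have phis : 0 <= phi s by case/EP: (Es).
have s1 : s < 1.
  rewrite lt_neqAle (andP s01).2 andbT; apply/eqP => s1.
  by move: phis; rewrite s1 leNgt phi1.
(* [W] is closed and misses [s], so every piece active close enough to [s] is active at [s] too. *)
pose W := \bigcup_(k in [set k | ~ C k s]) C k.
have Wcl : closed W.
  apply: closed_bigcup => //; exact: finite_finset.
have : nbhs s (~` W).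
  apply: open_nbhs_nbhs; split; first exact: closed_openC.
  by move=> [k].
case/nbhs_ballP => e /= e0 eW.
pose t := s + Num.min (e / 2) (1 - s).
have [st t1 tse] : [/\ s < t, t <= 1 & t - s < e].
  rewrite /t; have := e0; case: (leP (e / 2) (1 - s)) => h h'; split; lra.
have [k Ckt] : exists k, C k t by apply: Ccov; move: s01; lra.
have Cks : C k s.
  apply: contrapT => nCks; apply: (eW t); last by exists k.
  by rewrite /ball /= distrC ger0_norm; lra.
have phit : phi t < 0.
  rewrite ltNge; apply/negP => ge0; have : t <= s; last by rewrite leNgt st.
  apply: ub_le_sup; first by exists 1.
  by apply/EP; split=> //; move: s01; lra.
exists k; move: phit phis; rewrite (Cphi _ _ Ckt) (Cphi _ _ Cks) => h1 h2.
have bneg : b k < 0 by nra.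
split; nra.
Qed.

Lemma nonincreasing_piece (R : realType) (P : nat) (phi : R -> R)
    (a b : 'I_P -> R) (C : 'I_P -> set R) :
  (forall k, closed (C k)) ->
  (forall t, 0 <= t <= 1 -> exists k, C k t) ->
  (forall k t, C k t -> phi t = a k + b k * t) ->
  0 <= phi 0 -> phi 1 <= 0 ->
  exists k, 0 <= a k /\ a k + b k <= 0.
Proof.
move=> Ccl Ccov Cphi phi0 phi1; apply: contrapT => nk.
pose m k := Num.max (- a k) (a k + b k).
have m0 k : 0 < m k.
  rewrite /m lt_max ltNge oppr_le0 [X in _ || X]ltNge -negb_and.
  by apply/negP => /andP[h1 h2]; apply: nk; exists k.
(* Halving puts [e] strictly below every [m k]; the default 1 is a positive cap. *)
pose e := \big[Num.min/1]_k m k / 2.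
have min0 : 0 < \big[Num.min/1]_k m k by apply: lt_bigmin => // k _.
have e0 : 0 < e by rewrite /e divr_gt0.
have em k : e < m k.
  have : \big[Num.min/1]_k m k <= m k by exact: bigmin_le.
  by rewrite /e; lra.
(* Tilting phi by e reduces to strict end values; e is too small for the tilt
   to create a new piece of the required kind. *)
have [||||//|k [h1 h2]] := @decreasing_piece _ _ (fun t => phi t + e * (1 - 2 * t))
  (fun k => a k + e) (fun k => b k - 2 * e) C.
- by [].
- by [].
- by move=> k t /Cphi ->; ring.
- lra.
- lra.
- have := em k; rewrite /m lt_max => /orP[]; lra.
Qed.

Lemma hull_segment (R : realType) d N (x : 'I_N -> 'rV[R]_d) p q t :
  hull x p -> hull x q -> 0 <= t <= 1 -> hull x (p + t *: (q - p)).
Proof.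
move=> hp hq /andP[t0 t1] A [cA xA].
have := cA q p (Itv01 t0 t1); rewrite !inE => /(_ (hq A (conj cA xA)) (hp A (conj cA xA))).
congr A; transitivity (t *: q + (1 - t) *: p); first by [].
by rewrite scalerBl scale1r scalerBr [LHS]addrC addrAC addrA.
Qed.

Lemma mem_hull (R : realType) d N (x : 'I_N -> 'rV[R]_d) i : hull x (x i).
Proof. by move=> A [_ xA]; apply: xA; exists i. Qed.

Lemma affine_segment (R : realType) d (h : 'rV[R]_d -> R) p q t :
  affine_function h -> h (p + t *: (q - p)) = h p + (h q - h p) * t.
Proof. by move=> [l [b hE]]; rewrite !hE linearD linearZ linearB /=; ring. Qed.

Lemma affine_continuous (R : realType) d (h : 'rV[R]_d -> R) :
  affine_function h -> continuous h.
Proof.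
move=> [l [b hE]].
have -> : h = fun p => \sum_j p 0 j * l (delta_mx 0 j) + b.
  apply/funext => p; rewrite hE {1}(row_sum_delta p) linear_sum.
  by congr (_ + _); apply: eq_bigr => j _; rewrite linearZ.
have sumc : continuous (fun p : 'rV[R]_d => \sum_j p 0 j * l (delta_mx 0 j)).
  apply: (@continuous_big R _ +%R 0 xpredT (@add_continuous R)) => j _ p.
  exact: (continuousM (@coord_continuous R 1 d 0 j p) (@cst_continuous _ _ (l (delta_mx 0 j)) p)).
by move=> p; exact: (continuousD (sumc p) (@cst_continuous _ _ b p)).
Qed.

Lemma cpwl_cover (R : realType) d (D : set 'rV[R]_d) P (f : cpwl D P) p :
  D p -> exists k, dom f k p.
Proof. by have /seteqP[_ cov] := dom_cover f; move=> /cov[k _]; exists k. Qed.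

(** Subtract from [f], along the segment, the affine interpolant of its end values: the difference
    vanishes at both ends, so one of its pieces is nonnegative at [p] and nonpositive at [q]. *)
Lemma separating_piece (R : realType) d N P (x : 'I_N -> 'rV[R]_d)
    (f : cpwl (hull x) P) p q :
  hull x p -> hull x q ->
  exists k, f p <= piece f k p /\ piece f k q <= f q.
Proof.
move=> hp hq.
pose s t := p + t *: (q - p).
have scont : continuous s.
  move=> t; apply: cvgD; first exact: cvg_cst.
  by apply: cvgZr_tmp; exact: cvg_id.
have [|||||k [h1 h2]] := @nonincreasing_piece _ _
    (fun t => f (s t) - (f p + (f q - f p) * t))
    (fun k => piece f k p - f p)
    (fun k => (piece f k q - piece f k p) - (f q - f p))
    (fun k => s @^-1` dom f k).
- move=> k; apply: (iffLR (continuous_closedP _)) => //.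
  by apply: compact_closed; [exact: norm_hausdorff | exact: dom_compact].
- move=> t t01; exact: (cpwl_cover f (hull_segment hp hq t01)).
- move=> k t /= kt; rewrite (cpwl_piece kt) /s affine_segment; last exact: piece_affine.
  by ring.
- by rewrite /s scale0r addr0 mulr0 addr0 subrr.
- by rewrite /s scale1r mulr1 !subrKC subrr.
- by exists k; split; lra.
Qed.

(** * Continuous max-min selections *)

Lemma continuous_bigmin (R : realType) (T : topologicalType) (I : Type)
    (r : seq I) (Q : pred I) (u0 : T -> R) (u : I -> T -> R) :
  continuous u0 -> (forall i, continuous (u i)) ->
  continuous (fun p => \big[Num.min/u0 p]_(i <- r | Q i) u i p).
Proof.
move=> cu0 cu; elim: r => [|i r IH].
  by rewrite (funext (fun p => big_nil _ _ _ _)).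
rewrite (funext (fun p => big_cons _ _ _ _ _ _)).
by case: (Q i) => // p; exact: (continuous_min (cu i p) (IH p)).
Qed.

Lemma continuous_bigmax (R : realType) (T : topologicalType) (I : Type)
    (r : seq I) (Q : pred I) (u0 : T -> R) (u : I -> T -> R) :
  continuous u0 -> (forall i, continuous (u i)) ->
  continuous (fun p => \big[Num.max/u0 p]_(i <- r | Q i) u i p).
Proof.
move=> cu0 cu; elim: r => [|i r IH].
  by rewrite (funext (fun p => big_nil _ _ _ _)).
rewrite (funext (fun p => big_cons _ _ _ _ _ _)).
by case: (Q i) => // p; exact: (continuous_max (cu i p) (IH p)).
Qed.

Lemma cpwl_domain_compact (R : realType) d (D : set 'rV[R]_d) P
  (f : cpwl D P) : compact D.
Proof.
rewrite -(dom_cover f).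
rewrite (_ : \bigcup_k _ = \big[setU/set0]_(k <- enum 'I_P) dom f k).
  by apply: bigsetU_compact => k _; exact: dom_compact.
rewrite -bigcup_seq; apply: eq_bigcupl; split=> k //= _.
by rewrite mem_enum.
Qed.

(** The minimum [m i] is at least [w i] at [x i], while separation gives [m i (x j) <= w j]; so the
    maximum of the [m i] equals [w j] at [x j]. Sign compatibility carries these inequalities from
    [F] to [G]. *)
Lemma continuous_selection (R : realType) (T : topologicalType) (I J : finType)
    (F G : J -> T -> R) (x : I -> T) (w : I -> R) (i0 : I) :
  (forall k, continuous (G k)) ->
  (forall i, exists k, F k (x i) = w i) ->
  (forall i j, exists k, w i <= F k (x i) /\ F k (x j) <= w j) ->
  (forall k i, sign_compatible (F k (x i) - w i) (G k (x i) - w i)) ->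
  exists g : T -> R, [/\ continuous g, forall p, exists k, g p = G k p &
    forall i, g (x i) = w i].
Proof.
move=> Gcont /choice[kap Fkap] Fsep FG.
have Gge k i : w i <= F k (x i) -> w i <= G k (x i).
  by rewrite -!(subr_ge0 (w i)); exact: (FG k i).1.
have Gle k i : F k (x i) <= w i -> G k (x i) <= w i.
  by rewrite -!(subr_le0 (w i)); exact: (FG k i).2.
(* [F] selects the indices and [G] gives the values; [kap i] is itself a selected index, so the
   default value adds nothing. *)
pose m i p := \big[Num.min/G (kap i) p]_(k | w i <= F k (x i)) G k p.
have mcont i : continuous (m i) by exact: continuous_bigmin.
have msel i p : exists k, m i p = G k p.
  apply: (big_ind (fun y => exists k, y = G k p)).
  - by exists (kap i).
  - by move=> _ _ [k ->] [l ->]; case: leP; [exists k | exists l].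
  - by move=> k _; exists k.
exists (fun p => \big[Num.max/m i0 p]_i m i p); split.
- exact: continuous_bigmax.
- move=> p; apply: (big_ind (fun y => exists k, y = G k p)) => //.
  by move=> _ _ [k ->] [l ->]; case: leP; [exists l | exists k].
- move=> j.
  have mle i : m i (x j) <= w j.
    have [k [Fi Fj]] := Fsep i j.
    by apply: le_trans (Gle _ _ Fj); exact: bigmin_le_cond.
  apply/le_anti/andP; split; first exact: bigmax_le.
  apply: le_trans (le_bigmax _ _ j); apply: le_bigmin; last by move=> k /Gge.
  by apply: Gge; rewrite Fkap.
Qed.

(** * Assembling the well-behaved version *)

Theorem corollary1 (R : realType) (d N : nat) (eps : R)
    (x : 'I_N -> 'rV[R]_d) (z : 'I_N -> R)
    (hd : (1 <= d)%N) (heps : 0 <= eps) (hN : (d.+1 <= N)%N)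
    (hx : general_position x)
    (P : nat) (f : cpwl (hull x) P) (hf : approximates x z eps f) :
  exists g : cpwl (hull x) P, well_behaved_version_approx z eps f g.
Proof.
pose w i := f (x i).
have vertex k := affine_vertex w hN hx (piece_affine f k).
have {vertex}/choice[G GP] := vertex.
have Gaff k : affine_function (G k) by case: (GP k).
have Gsgn k i : sign_compatible (piece f k (x i) - w i) (G k (x i) - w i).
  by case: (GP k).
have Gact k : (d.+1 <= #|active (G k \o x) w|)%N by case: (GP k).
have active_piece i : exists k, dom f k (x i).
  exact: (cpwl_cover f (@mem_hull _ _ _ x i)).
pose i0 : 'I_N := Ordinal (leq_trans (ltn0Sn d) hN).
have [||||g [gcont gsel gx]] := @continuous_selection _ _ _ _ (piece f) G x w i0.
- by move=> k; exact: affine_continuous.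
- by move=> i; have [k kx] := active_piece i; exists k; rewrite -(cpwl_piece kx).
- by move=> i j; apply: separating_piece; exact: mem_hull.
- exact: Gsgn.
(* The k-th domain is the whole agreement set of [g] and [G k] in the hull, so that it contains
   every point at which [G k] is active. *)
have gdomc k : compact (hull x `&` [set p | g p = G k p]).
  apply: subclosed_compact (@subIsetl _ _ _); last exact: (cpwl_domain_compact f).
  apply: closedI.
    by apply: compact_closed; [exact: norm_hausdorff | exact: (cpwl_domain_compact f)].
  rewrite (_ : [set p | _] = (fun p => g p - G k p) @^-1` [set y | y = 0]).
    apply: (iffLR (continuous_closedP _)); last exact: closed_eq.
    by move=> p; exact: (continuousB (gcont p) (affine_continuous (Gaff k) (x := p))).
  by apply/seteqP; split=> p /= => [->|/subr0_eq //]; rewrite subrr.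
have gcov : \bigcup_k (hull x `&` [set p | g p = G k p]) = hull x.
  apply/seteqP; split=> [p [k _ []] //|p hp].
  by have [k gk] := gsel p; exists k.
have gpiece k p : (hull x `&` [set p | g p = G k p]) p -> g p = G k p by case.
exists (Cpwl (continuous_subspaceT gcont) Gaff gdomc gcov gpiece).
have wE i : z i + (f (x i) - z i) = w i by rewrite addrC subrK.
split => //.
  (* [f] and [g] agree at every [x i], so their errors are the same. *)
  rewrite /approximates (le_trans _ hf) // le_eqVlt; apply/orP; left; apply/eqP.
  by apply: eq_bigr => i _ /=; rewrite gx.
split => [i||k p [kp [i _ xip]]]; first by rewrite wE.
  split=> [i|k]; first by rewrite wE /= gx.
  exists (active (G k \o x) w); split=> // i; rewrite active_in => /eqP /= Gi.
  split=> /=; last by rewrite wE.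
  by split; [exact: mem_hull | rewrite /= gx Gi].
split; last by exists i.
rewrite -xip in kp *; split; first exact: mem_hull.
(* On [dom f k] the k-th piece of [f] equals [w i] at [x i]; a zero difference stays zero, so [G k]
   takes the value [w i] there as well. *)
rewrite /= gx; have := Gsgn k i.
by rewrite -(cpwl_piece kp) subrr => /sign_compatible0/subr0_eq.
Qed.
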